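(* (i) For every fixed odd prime power $q$ and every $x\in\mathbb F_q$, if $A_n\in\mathbb F_q^{n\times n}$ is uniformly random, then \[ \lim_{n\to\infty}\Pr[\operatorname{per}(A_n)=x]=\frac1q . \] (ii) More precisely, for every odd prime power $q$, every $n\geq 7$, and uniformly random $A_n\in\mathbb F_q^{n\times n}$, one has \[ d_{\mathrm{TV}}\!\left(\mathcal L(\operatorname{per}(A_n)),\mathsf U_q\right) \leq \frac{1}{n}\left[ \frac{10}{27}\left(\frac{\log n}{\log(27/19)}+1\right)+\frac{1}{9} \right]. \] (iii) Consequently, the total-variation distance is $O((\log n)/n)$ uniformly over all odd prime powers: there is an absolute constant $C>0$ such that $d_{\mathrm{TV}}(\mathcal L(\operatorname{per}(A_n)),\mathsf U_q)\leq C\frac{\log n}{n}$ for every odd prime power $q$ and every $n\geq 7$. The same conclusion holds for every sequence of odd prime powers $q=q(n)$: if $A_n\in\mathbb F_{q(n)}^{n\times n}$ is uniformly random, then $d_{\mathrm{TV}}(\mathcal L(\operatorname{per}(A_n)),\mathsf U_{q(n)})=O((\log n)/n)$ as $n\to\infty$.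
   Context: $\mathbb F_q$ is the finite field with $q$ elements. For $A=(a_{ij})\in\mathbb F_q^{n\times n}$, the permanent is $\operatorname{per}(A)=\sum_{\sigma\in S_n}\prod_{i=1}^n a_{i,\sigma(i)}\in\mathbb F_q$, where $S_n$ is the symmetric group on $[n]=\{1,\dots,n\}$. A uniformly random matrix has independent entries, each uniformly distributed on $\mathbb F_q$. For probability measures $\mu,\nu$ on $\mathbb F_q$, $d_{\mathrm{TV}}(\mu,\nu)=\frac12\sum_{x\in\mathbb F_q}|\mu(x)-\nu(x)|$. $\mathsf U_q$ is the uniform probability measure on $\mathbb F_q$, and $\mathcal L(X)$ is the law of a random variable $X$. $\log$ is the natural logarithm. *)

(* Defs.v *)
From HB Require Import structures.
From mathcomp Require Export all_boot all_order all_algebra all_fingroup.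
From mathcomp Require Export all_classical all_reals all_analysis.
Export Order.TTheory GRing.Theory Num.Theory numFieldNormedType.Exports.

Set Implicit Arguments.
Unset Strict Implicit.
Unset Printing Implicit Defensive.

Local Open Scope classical_set_scope.
Local Open Scope ring_scope.

Definition permanent (K : comNzRingType) (n : nat) (A : 'M[K]_n) : K :=
  \sum_(s : 'S_n) \prod_(i < n) A i (s i).

Section FiniteValuedRandomVariables.
Context (R : realType) (d : measure_display) (T : measurableType d).
Variable P : probability T R.

(* The finite target [S] carries the sigma-algebra of all its subsets. *)
Definition finite_rv (S : finType) (X : T -> S) : Prop :=
  forall B : set S, measurable (X @^-1` B).

Definition mutually_independent (I S : finType) (X : I -> T -> S) : Prop :=
  forall (J : {set I}) (B : I -> set S),
    fine (P (\bigcap_(i in [set` J]) (X i @^-1` B i))) =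
    \prod_(i in J) fine (P (X i @^-1` B i)).

(* A law on a finite type is represented by its mass function. *)
Definition law (S : finType) (X : T -> S) : S -> R :=
  fun x => fine (P (X @^-1` [set x])).

Definition uniform_law (S : finType) : S -> R := fun=> #|S|%:R^-1.

Definition uniform_random_matrix (F : finFieldType) (n : nat)
    (A : T -> 'M[F]_n) : Prop :=
  let entry (ij : 'I_n * 'I_n) (t : T) : F := A t ij.1 ij.2 in
  [/\ forall ij, finite_rv (entry ij),
      forall ij, law (entry ij) = @uniform_law F
    & mutually_independent entry].

End FiniteValuedRandomVariables.

Arguments uniform_law R S : clear implicits.

Definition dTV (R : realType) (S : finType) (mu nu : S -> R) : R :=
  2^-1 * \sum_(x : S) `|mu x - nu x|.

Definition per_dTV (R : realType) (d : measure_display) (T : measurableType d)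
    (P : probability T R) (F : finFieldType) (n : nat) (A : T -> 'M[F]_n) : R :=
  dTV (law P (fun t => permanent (A t))) (uniform_law R F).

(* Main.v *)
Require Import Defs.
From mathcomp Require Import cyclic ring lra zify.

Set Implicit Arguments.
Unset Strict Implicit.
Unset Printing Implicit Defensive.

Local Open Scope classical_set_scope.
Local Open Scope ring_scope.

(** The bound proved here is exponential: for odd q and n >= 1 the distance is
    at most (2/9) (9/10)^(n-1), which is at most 2/n, and all the assertions
    follow because ln n >= 5 ln (27/19) for n >= 7.

    The permanent is the coefficient of x_1 ... x_n in the product of the rows
    of the matrix, read as linear forms in the squarefree algebra
    F[x_1, ..., x_n] / (x_1^2, ..., x_n^2).  Condition on all rows but one.  If
    the product of these n - 1 rows is nonzero, the permanent is a nonzero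
    linear functional of the last row, hence uniform; otherwise it is zero.  So
    the distance to uniformity is (1 - 1/q) p(n-1, n), where p(k, N) is the
    probability that the product of k random linear forms in N variables is
    zero, that is, that all k x k permanental minors of a random k x N matrix
    vanish.

    To bound p(k, N+1), fix the first column c of the matrix and let the other
    entries be random.
    - Replacing an entry of c by 0 can only increase the probability that the
      product vanishes: in the row of that entry, vanishing is an affine system
      whose homogeneous version is obtained by the replacement
      ([vanish_col_rcons0]).
    - If c = 0 the probability is p(k, N); if c has one nonzero entry it is
      p(k-1, N).
    - Let c have exactly two nonzero entries, let D be the product of the other
      k - 2 rows and x, y the two rows, without their first entries.  The
      product vanishes iff x' D = 0 and x y D = 0, where x' is a combination of
      x and y independent of x; as x y D is, modulo x' D, a nonzero multiple of
      x^2 D, this means x' D = 0 and x^2 D = 0, which are independent events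
      given D.  In odd characteristic x^2 D is a nonzero quadratic map in x
      when D <> 0, and it is zero with probability at most
      alpha = 1 - (1 - 1/q)^2 <= 5/9.  Hence the probability is at most
      alpha p(k-1, N) + (1 - alpha) p(k-2, N) ([vanish_col_pair]).

    Averaging over c gives a recursion for p.  Without the third item it yields
    the bound p(k, N) <= (q^k - 1) / ((q - 1) q^N) ([minors_prob_le_proj]).
    With it, and up to a term of order q^(-N), p(k, N) loses a constant
    factor each time k grows by one with N - k fixed, because p(k-2, N) has
    excess N - k + 2 and is therefore smaller by a further factor q; this gives
    p(k, N) <= (9/10)^k q^(k-N) for k < N ([minors_prob_exp_decay]). *)

(** * Averages over finite types *)

Section Average.
Variable R : realFieldType.

Definition avg (T : finType) (f : T -> R) : R := #|T|%:R^-1 * \sum_t f t.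

Lemma eq_avg (T : finType) (f g : T -> R) : f =1 g -> avg f = avg g.
Proof. by move=> fg; rewrite /avg; under eq_bigr do rewrite fg. Qed.

Lemma le_avg (T : finType) (f g : T -> R) :
  (forall t, f t <= g t) -> avg f <= avg g.
Proof.
move=> fg; rewrite /avg ler_wpM2l ?invr_ge0 ?ler0n //.
by apply: ler_sum => t _; exact: fg.
Qed.

Lemma avg_const (T : finType) (a : R) :
  (0 < #|T|)%N -> avg (fun _ : T => a) = a.
Proof.
move=> T0; rewrite /avg sumr_const -[a *+ _]mulr_natr mulrCA mulVf ?mulr1 //.
by rewrite pnatr_eq0 -lt0n.
Qed.

Lemma avgD (T : finType) (f g : T -> R) :
  avg (fun t => f t + g t) = avg f + avg g.
Proof. by rewrite /avg big_split mulrDr. Qed.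

Lemma avgZ (T : finType) (a : R) (f : T -> R) :
  avg (fun t => a * f t) = a * avg f.
Proof. by rewrite /avg -mulr_sumr mulrCA. Qed.

Lemma avg_pair (T U : finType) (f : T * U -> R) :
  avg f = avg (fun t => avg (fun u => f (t, u))).
Proof.
rewrite /avg card_prod natrM invfM -mulr_sumr pair_big /= mulrA.
by congr (_ * _); apply: eq_bigr => -[].
Qed.

Lemma exchange_avg (T U : finType) (f : T -> U -> R) :
  avg (fun t => avg (fun u => f t u)) = avg (fun u => avg (fun t => f t u)).
Proof. by rewrite /avg -!mulr_sumr exchange_big mulrCA. Qed.

Lemma avg_bij (T U : finType) (h : T -> U) (f : U -> R) :
  bijective h -> avg (fun t => f (h t)) = avg f.
Proof.
move=> hb; rewrite /avg (bij_eq_card hb); congr (_ * _).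
by rewrite [RHS](reindex h) //; exact: onW_bij.
Qed.

Lemma avg_eq1 (T : finType) (a : T) :
  avg (fun t => (t == a)%:R) = #|T|%:R^-1.
Proof.
rewrite /avg (bigD1 a) //= eqxx big1 ?addr0 ?mulr1 // => t /negPf-> //.
Qed.

Lemma avg_ge0 (T : finType) (f : T -> R) : (forall t, 0 <= f t) -> 0 <= avg f.
Proof. by move=> f0; rewrite mulr_ge0 ?invr_ge0 ?ler0n ?sumr_ge0. Qed.

End Average.

(** * The squarefree algebra *)

Fixpoint vec_of (T : finType) (n : nat) : finType :=
  if n is m.+1 then (T * vec_of T m)%type else unit.

(** The algebra F[x_1, ..., x_N] / (x_1^2, ..., x_N^2) as a vector space: a
    pair (a, b) stands for a + x_1 b with a and b free of x_1.  With this
    encoding, removing the first column of a matrix is structural recursion. *)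
Fixpoint sqf (F : finFieldType) (N : nat) : lmodType F :=
  if N is M.+1 then (sqf F M * sqf F M)%type else F^o.

Section SquarefreeAlgebra.
Variable F : finFieldType.
Local Notation vec := (vec_of F).
Local Notation sqf := (sqf F).

(** Only products by linear forms are ever needed, so the multiplication of the
    algebra is defined with a vector of coefficients as its left factor. *)
Fixpoint mul_form N : vec N -> sqf N -> sqf N :=
  if N is M.+1 then
    fun x f => (mul_form x.2 f.1, mul_form x.2 f.2 + x.1 *: f.1)
  else fun _ _ => 0.

Fixpoint add_form N : vec N -> vec N -> vec N :=
  if N is M.+1 then fun x y => (x.1 + y.1, add_form x.2 y.2) else fun _ _ => tt.

Fixpoint scale_form (a : F) N : vec N -> vec N :=
  if N is M.+1 then fun x => (a * x.1, scale_form a x.2) else fun _ => tt.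

Fixpoint sqf_one N : sqf N := if N is M.+1 then (sqf_one M, 0) else (1 : F^o).

Fixpoint top_coef N : sqf N -> F :=
  if N is M.+1 then fun f => top_coef f.2 else fun f => f.

(** The zero element is homogeneous of every degree. *)
Fixpoint homog N : nat -> sqf N -> Prop :=
  if N is M.+1 then
    fun d f => homog d f.1 /\ (if d is e.+1 then homog e f.2 else f.2 = 0)
  else fun d f => (0 < d)%N -> f = 0.

Lemma mul_formD N (x : vec N) f g :
  mul_form x (f + g) = mul_form x f + mul_form x g.
Proof.
elim: N x f g => [|N IH] /= x f g; first by rewrite addr0.
by rewrite !IH scalerDr; congr pair; rewrite /= addrACA.
Qed.

Lemma mul_formZ N (x : vec N) a f : mul_form x (a *: f) = a *: mul_form x f.
Proof.
elim: N x f => [|N IH] /= x f; first by rewrite scaler0.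
by rewrite !IH; congr pair => /=; rewrite scalerDr !scalerA mulrC.
Qed.

Lemma mul_form0 N (x : vec N) : mul_form x 0 = 0.
Proof. by have := mul_formZ x 0 0; rewrite !scale0r. Qed.

Lemma mul_add_form N (x y : vec N) f :
  mul_form (add_form x y) f = mul_form x f + mul_form y f.
Proof.
elim: N x y f => [|N IH] /= x y f; first by rewrite addr0.
by rewrite !IH scalerDl; congr pair; rewrite /= addrACA.
Qed.

Lemma mul_scale_form N a (x : vec N) f :
  mul_form (scale_form a x) f = a *: mul_form x f.
Proof.
elim: N x f => [|N IH] /= x f; first by rewrite scaler0.
by rewrite !IH; congr pair => /=; rewrite scalerDr !scalerA.
Qed.

Lemma mul_formC N (x y : vec N) f :
  mul_form x (mul_form y f) = mul_form y (mul_form x f).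
Proof.
elim: N x y f => [//|N IH] /= x y f.
rewrite IH; congr pair; rewrite /= !mul_formD !mul_formZ.
rewrite [mul_form x.2 (mul_form y.2 _)]IH.
by rewrite -!addrA [X in _ + X]addrC.
Qed.

Lemma homog0 N d : homog d (0 : sqf N).
Proof. by elim: N d => [|N IH] [|d] //=. Qed.

Lemma homogD N d (f g : sqf N) : homog d f -> homog d g -> homog d (f + g).
Proof.
elim: N d f g => [|N IH] d f g /=.
  by move=> f0 g0 d0; rewrite f0 // g0 // addr0.
case=> f1 f2 [g1 g2]; split; first exact: IH.
case: d f1 f2 g1 g2 => [|d] f1 f2 g1 g2; last exact: IH.
by rewrite f2 g2 addr0.
Qed.

Lemma homogZ N d a (f : sqf N) : homog d f -> homog d (a *: f).
Proof.
elim: N d f => [|N IH] d f /=; first by move=> f0 d0; rewrite f0 // scaler0.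
case=> f1 f2; split; first exact: IH.
by case: d f1 f2 => [|d] f1 f2; [rewrite f2 scaler0|exact: IH].
Qed.

Lemma homog_mul_form N d (x : vec N) f : homog d f -> homog d.+1 (mul_form x f).
Proof.
elim: N d x f => [|N IH] d x f //= [f1 f2]; split; first exact: IH.
apply: homogD; last exact: homogZ.
by case: d f1 f2 => [|d] f1 f2; [rewrite f2 mul_form0; exact: homog0|exact: IH].
Qed.

Lemma homog_one N : homog 0 (sqf_one N).
Proof. by elim: N => [|N IH]. Qed.

Lemma one_neq0 N : sqf_one N != 0.
Proof.
elim: N => [|N IH] /=; first exact: oner_neq0.
by apply: contra_neq IH => -[].
Qed.

Lemma homog_gt N d (f : sqf N) : homog d f -> (N < d)%N -> f = 0.
Proof.
elim: N d f => [|N IH] d f //=.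
case: d => // d [f1 f2] Nd; case: f f1 f2 => a b /= f1 f2.
by rewrite (IH _ _ f1) ?(IH _ _ f2) // ltnW.
Qed.

Lemma top_inj N (f : sqf N) : homog N f -> top_coef f = 0 -> f = 0.
Proof.
elim: N f => [|N IH] f //=; case: f => a b /= [a1 b1] b0.
by rewrite (homog_gt a1) // (IH b).
Qed.

End SquarefreeAlgebra.

(** * Probability that a product of random linear forms vanishes *)

Section Vanishing.
Variables (R : realFieldType) (F : finFieldType).
Hypothesis odd_F : odd #|F|.
Local Notation vec := (vec_of F).
Local Notation sqf := (sqf F).
Local Notation q := (#|F|%:R : R).

Fixpoint mul_rows N k : vec_of (vec N) k -> sqf N -> sqf N :=
  if k is j.+1 then fun r g => mul_rows r.2 (mul_form r.1 g) else fun _ g => g.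

Definition vanish_prob N (g : sqf N) k : R :=
  avg (fun r : vec_of (vec N) k => (mul_rows r g == 0)%:R).

(** The conditional version of [vanish_prob] in which the coefficients of x_1 in
    the successive forms are the entries of s. *)
Fixpoint vanish_col N (g : sqf N.+1) (s : seq F) : R :=
  if s is c :: s' then
    avg (fun x : vec N => vanish_col (@mul_form F N.+1 (c, x) g) s')
  else (g == 0)%:R.

Fixpoint vseq n : vec n -> seq F :=
  if n is m.+1 then fun x => x.1 :: vseq x.2 else fun _ => [::].

Lemma size_vseq n (x : vec n) : size (vseq x) = n.
Proof. by elim: n x => //= n IH x; rewrite IH. Qed.

Lemma card_vec (T : finType) n : #|vec_of T n| = (#|T| ^ n)%N.
Proof.
elim: n => [|n IH] /=; first by rewrite card_unit.
by rewrite card_prod IH expnS.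
Qed.

Lemma avg_cons (T : finType) n (f : vec_of T n.+1 -> R) :
  avg f = avg (fun t => avg (fun u : vec_of T n => f (t, u))).
Proof. exact: avg_pair. Qed.

Lemma card_F_ge3 : (3 <= #|F|)%N.
Proof. by have := card_finNzRing_gt1 F; case: #|F| odd_F => [|[|[|]]]. Qed.

Lemma q_ge3 : 3 <= q.
Proof. by rewrite ler_nat card_F_ge3. Qed.

Lemma F_two_neq0 : (2 : F) != 0.
Proof.
apply/eqP => two0; pose x : F := 1.
have o2 : (#[x]%g %| 2)%N by rewrite order_dvdn FinRing.zmodXgE; apply/eqP.
have oF : (#[x]%g %| #|F|)%N by rewrite -cardsT order_dvdG ?inE.
have /eqP : #[x]%g = 1%N.
  have := dvdn_leq (isT : (0 < 2)%N) o2; have := dvdn_odd oF odd_F.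
  have := order_gt0 x.
  by case: #[x]%g => [|[|[|]]].
by rewrite order_eq1; apply/negP; exact: oner_neq0.
Qed.

Lemma vec_gt0 (T : finType) n : (0 < #|T|)%N -> (0 < #|vec_of T n|)%N.
Proof. by move=> T0; rewrite card_vec expn_gt0 T0. Qed.

Lemma F_gt0 : (0 < #|F|)%N.
Proof. exact: ltnW (card_finNzRing_gt1 F). Qed.

Lemma vecF_gt0 n : (0 < #|vec n|)%N.
Proof. by apply: vec_gt0; exact: F_gt0. Qed.

Lemma ler_bool (a b : bool) : (a -> b) -> a%:R <= b%:R :> R.
Proof. by case: a b => [] [] => //= h; have := h isT. Qed.

Lemma avg_affine_le (V : lmodType F) (a b : V) : a != 0 ->
  avg (fun c => (b + c *: a == 0)%:R) <= q^-1.
Proof.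
move=> a0; have [/existsP[c0 /eqP c0E]|] := boolP [exists c, b + c *: a == 0].
  rewrite -(avg_eq1 R c0); apply: le_avg => c; apply: ler_bool => /eqP cE.
  apply: contraT => cc0; have : (c - c0) *: a == 0.
    by rewrite scalerBl -[c *: a](addKr b) cE -[c0 *: a](addKr b) c0E subrr.
  by rewrite scaler_eq0 (negbTE a0) orbF subr_eq0 (negbTE cc0).
move=> /existsPn noc; rewrite (eq_avg (g := fun=> 0)).
  by rewrite avg_const ?F_gt0 // invr_ge0.
by move=> c; rewrite (negbTE (noc c)).
Qed.

(** A nonzero element of degree below N survives a random linear form: in the
    leading case the coefficient of x_1 is an affine function of the first
    coefficient of the form, with nonzero slope. *)
Lemma linear_vanish_le N d (f : sqf N) : f != 0 -> homog d f -> (d < N)%N ->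
  avg (fun x => (mul_form x f == 0)%:R) <= q^-1.
Proof.
elim: N d f => [//|N IH] d [a b] /= f0 [ha hb] dN.
rewrite avg_cons exchange_avg.
have [a0|a0] := eqVneq a 0; last first.
  rewrite -[X in _ <= X](avg_const _ (vecF_gt0 N)); apply: le_avg => x.
  apply: le_trans (avg_affine_le (mul_form x b) a0).
  by apply: le_avg => c; apply: ler_bool => /eqP[_ /= ->].
case: d hb ha dN => [b0|d hb] _ dN.
  by rewrite a0 b0 eqxx in f0.
have b0 : b != 0 by apply: contra_neq f0 => ->; rewrite a0.
apply: le_trans (IH d b b0 hb dN); apply: le_avg => x.
rewrite -[X in _ <= X](avg_const _ F_gt0); apply: le_avg => c.
by apply: ler_bool => /eqP[_ /=]; rewrite a0 scaler0 addr0 => ->.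
Qed.

(** For f = a + x_1 b with a <> 0 and a form c x_1 + l, the x_1-part of the
    square times f is l^2 b + 2 c l a.  Since 2 is invertible, it is nonzero
    with probability at least 1 - 1/q given that l a is nonzero, which itself
    has probability at least 1 - 1/q.  If a = 0, the element b takes over, with
    both the degree and the number of variables lowered by one. *)
Lemma sq_vanish_le N d (f : sqf N) : f != 0 -> homog d f -> (d.+2 <= N)%N ->
  avg (fun x => (mul_form x (mul_form x f) == 0)%:R) <= 1 - (1 - q^-1) ^+ 2.
Proof.
elim: N d f => [//|N IH] d [a b] /= f0 [ha hb] dN.
rewrite avg_cons exchange_avg.
have q3 := q_ge3.
have sqE x c : mul_form x (mul_form x b + c *: a) + c *: mul_form x a =
    mul_form x (mul_form x b) + c *: (2 *: mul_form x a).
  by rewrite mul_formD mul_formZ -addrA -scalerDr -mulr2n scaler_nat.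
have [a0|a0] := eqVneq a 0; last first.
  apply: (@le_trans _ _
    (avg (fun x => q^-1 + (1 - q^-1) * (mul_form x a == 0)%:R))).
    apply: le_avg => x; have [xa|xa] := eqVneq (mul_form x a) 0.
      rewrite mulr1 [X in _ <= X]addrC subrK.
      rewrite -[X in _ <= X](avg_const _ F_gt0); apply: le_avg => c.
      by case: (_ == _).
    rewrite mulr0 addr0.
    have xa2 : 2 *: mul_form x a != 0.
      by rewrite scaler_eq0 negb_or F_two_neq0 xa.
    apply: le_trans (avg_affine_le (mul_form x (mul_form x b)) xa2).
    by apply: le_avg => c; apply: ler_bool => /eqP[_ /=]; rewrite sqE => ->.
  rewrite avgD avg_const ?vecF_gt0 // avgZ.
  have := linear_vanish_le a0 ha dN; set p := avg _ => pq.
  have qi : q^-1 <= 1 by rewrite invf_le1; lra.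
  have -> : 1 - (1 - q^-1) ^+ 2 = q^-1 + (1 - q^-1) * q^-1 by ring.
  by rewrite lerD2l ler_wpM2l // subr_ge0.
case: d hb ha dN => [b0|d hb] _ dN.
  by rewrite a0 b0 eqxx in f0.
have b0 : b != 0 by apply: contra_neq f0 => ->; rewrite a0.
apply: le_trans (IH d b b0 hb dN); apply: le_avg => x.
rewrite -[X in _ <= X](avg_const _ F_gt0); apply: le_avg => c.
apply: ler_bool => /eqP[_ /=]; rewrite sqE a0 mul_form0 !scaler0 addr0 => ->.
by rewrite eqxx.
Qed.

Lemma vanish_prob0 N (g : sqf N) : vanish_prob g 0 = (g == 0)%:R.
Proof. by rewrite /vanish_prob /= avg_const ?card_unit. Qed.

Lemma vanish_probS N (g : sqf N) k :
  vanish_prob g k.+1 = avg (fun x => vanish_prob (mul_form x g) k).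
Proof. by rewrite /vanish_prob avg_pair. Qed.

Lemma vanish_prob_avg_col N (g : sqf N.+1) k :
  vanish_prob g k = avg (fun c : vec k => vanish_col g (vseq c)).
Proof.
elim: k g => [|k IH] g; first by rewrite vanish_prob0 /= avg_const ?card_unit.
rewrite vanish_probS !avg_cons; apply: eq_avg => c /=.
by rewrite [RHS]exchange_avg; apply: eq_avg => x; rewrite IH.
Qed.

Lemma vanish_prob_zero N k : vanish_prob (0 : sqf N) k = 1.
Proof.
elim: k => [|k IH]; first by rewrite vanish_prob0 eqxx.
rewrite vanish_probS (eq_avg (g := fun=> 1)) ?avg_const ?vecF_gt0 // => x.
by rewrite mul_form0.
Qed.

Lemma vanish_prob_le1 N (g : sqf N) k : vanish_prob g k <= 1.
Proof.
have V0 := vec_gt0 k (vecF_gt0 N).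
rewrite -[X in _ <= X](avg_const 1 V0).
by apply: le_avg => r; case: (_ == _).
Qed.

Lemma vanish_prob_ge0 N (g : sqf N) k : 0 <= vanish_prob g k.
Proof. by apply: avg_ge0 => r; case: (_ == _). Qed.

Lemma vanish_col_le1 N (g : sqf N.+1) s : vanish_col g s <= 1.
Proof.
elim: s g => [|c s IH] g /=; first by case: (_ == _).
by rewrite -[X in _ <= X](avg_const 1 (vecF_gt0 N)); apply: le_avg.
Qed.

(** Since multiplications by forms commute, the entry at the head of the column
    may be treated last; hence so may any entry. *)
Lemma vanish_col_rcons N (g : sqf N.+1) c s :
  vanish_col g (c :: s) = vanish_col g (rcons s c).
Proof.
elim: s g => [//|b s IH] g.
have -> : vanish_col g (rcons (b :: s) c) =
    avg (fun y => vanish_col (@mul_form F N.+1 (b, y) g) (rcons s c)) by [].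
under [RHS]eq_avg do rewrite -IH.
rewrite [LHS]exchange_avg; apply: eq_avg => x; apply: eq_avg => y.
by rewrite mul_formC.
Qed.

Lemma vanish_col_cat N (g : sqf N.+1) s t :
  vanish_col g (s ++ t) = vanish_col g (t ++ s).
Proof.
elim: s t => [|c s IH] t; first by rewrite cats0.
by rewrite cat_cons vanish_col_rcons -cats1 -catA IH -catA.
Qed.

Lemma add_form_bij N (x : vec N) : bijective (add_form x).
Proof.
apply: injF_bij; elim: N x => [|N IH] /= x; first by case=> [] [].
by move=> [a y] [b z] [/addrI-> /IH->].
Qed.

Lemma scale_form_bij N (c : F) : c != 0 -> bijective (@scale_form F c N).
Proof.
move=> c0; apply: injF_bij; elim: N => [|N IH] /=; first by case=> [] [].
by move=> [a y] [b z] [/(mulfI c0)-> /IH->].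
Qed.

(** The last form solves an affine system depending on c whose homogeneous
    version is the case c = 0: subtracting a fixed solution z injects the
    solutions for c into those for 0. *)
Lemma vanish_col_rcons0 N (g : sqf N.+1) c s :
  vanish_col g (rcons s c) <= vanish_col g (rcons s 0).
Proof.
elim: s g => [|b s IH] g; last by apply: le_avg => x; exact: IH.
case: g => a b /=.
have [/existsP[z /eqP[za zb]]|noz] :=
    boolP [exists z, (mul_form z a, mul_form z b + c *: a) == 0]; last first.
  rewrite (eq_avg (g := fun=> 0)); last first.
    by move=> x; move/existsPn/(_ x)/negbTE: noz => ->.
  rewrite avg_const ?vecF_gt0 //.
  by apply: avg_ge0 => x; case: (_ == _).
rewrite -(avg_bij _ (add_form_bij z)); apply: le_avg => x; apply: ler_bool.
rewrite !mul_add_form => /eqP[xa xb]; rewrite scale0r addr0.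
have xa0 : mul_form x a = 0 by rewrite -xa za add0r.
by rewrite xa0; move: xb; rewrite addrAC zb add0r => ->.
Qed.

Lemma vanish_col_head0 N (g : sqf N.+1) c s :
  vanish_col g (c :: s) <= vanish_col g (0 :: s).
Proof. by rewrite !vanish_col_rcons vanish_col_rcons0. Qed.

Lemma vanish_col_prefix0 N (g : sqf N.+1) s t :
  vanish_col g (s ++ t) <= vanish_col g (nseq (size s) 0 ++ t).
Proof.
elim: s g => [//|c s IH] g; apply: (le_trans (vanish_col_head0 _ _ _)).
by apply: le_avg => x; exact: IH.
Qed.

Lemma vanish_col_nseq0 N (g : sqf N) k :
  @vanish_col N (g, 0) (nseq k 0) = vanish_prob g k.
Proof.
elim: k g => [|k IH] g.
  by rewrite vanish_prob0 /=; congr (_%:R); rewrite xpair_eqE eqxx andbT.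
by rewrite vanish_probS; apply: eq_avg => x /=; rewrite mul_form0 scale0r addr0.
Qed.

(** The last form contributes c times the product g' of the others to the
    x_1-part, so that the whole product vanishes iff g' does. *)
Lemma vanish_col_single N (g : sqf N) k c : c != 0 ->
  @vanish_col N (g, 0) (nseq k 0 ++ [:: c]) = vanish_prob g k.
Proof.
move=> c0; elim: k g => [|k IH] g.
  rewrite vanish_prob0 /= (eq_avg (g := fun=> (g == 0)%:R)).
    by rewrite avg_const ?vecF_gt0.
  move=> x; congr (_%:R); rewrite mul_form0 add0r xpair_eqE.
  rewrite scaler_eq0 (negbTE c0) /=.
  by have [->|] := eqVneq g 0; rewrite ?mul_form0 ?eqxx ?andbF.
by rewrite vanish_probS; apply: eq_avg => x /=; rewrite mul_form0 scale0r addr0.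
Qed.

Local Notation beta := ((1 - q^-1) ^+ 2).
Local Notation alpha := (1 - (1 - q^-1) ^+ 2).

(** This is where probability is gained.  For forms x, y with first coefficients
    c, c', the product with g vanishes iff (c y + c' x) g = 0 and x y g = 0;
    in the presence of the former the latter says x^2 g = 0. *)
Lemma vanish_col_pair N d (g : sqf N) k c c' : c != 0 -> c' != 0 ->
  homog d g -> (d + k.+2 <= N)%N ->
  @vanish_col N (g, 0) (nseq k 0 ++ [:: c; c']) <=
  alpha * vanish_prob g k.+1 + (1 - alpha) * vanish_prob g k.
Proof.
move=> c0 c'0; elim: k d g => [|k IH] d g hg dk; last first.
  rewrite [vanish_prob g k.+2]vanish_probS [vanish_prob g k.+1]vanish_probS.
  rewrite -!avgZ -avgD.
  apply: le_avg => x /=; rewrite mul_form0 scale0r addr0.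
  by apply: IH (homog_mul_form x hg) _; rewrite addSnnS.
have [->|g0] := eqVneq g 0.
  by rewrite !vanish_prob_zero !mulr1 [X in _ <= X]addrC subrK vanish_col_le1.
rewrite vanish_prob0 (negbTE g0) mulr0 addr0 vanish_probS.
under [avg (fun x => vanish_prob _ 0)]eq_avg do rewrite vanish_prob0.
apply: (@le_trans _ _ (avg (fun x : vec N => avg (fun y : vec N =>
  (mul_form x (mul_form x g) == 0)%:R * (mul_form y g == 0)%:R)))); last first.
  rewrite (eq_avg (g := fun x : vec N => avg (fun y : vec N =>
    (mul_form y g == 0)%:R) * (mul_form x (mul_form x g) == 0)%:R)); last first.
    by move=> x; rewrite avgZ mulrC.
  rewrite avgZ mulrC ler_wpM2r //; first by apply: avg_ge0 => x; case: (_ == _).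
  by apply: sq_vanish_le hg _ => //; rewrite -addn2.
apply: le_avg => x /=.
(* Substitute y := c y + c' x on the right-hand side. *)
rewrite -(avg_bij (fun y => _ * (mul_form y g == 0)%:R)
  (add_form_bij (scale_form c' x))).
rewrite -(avg_bij (fun y => _ * (mul_form (add_form _ y) g == 0)%:R)
  (scale_form_bij N c0)).
apply: le_avg => y; rewrite -natrM mulnb; apply: ler_bool => /eqP[].
rewrite mul_form0 add0r mul_formZ => yx yg.
have y0 : c' *: mul_form x g + c *: mul_form y g = 0 by rewrite addrC.
rewrite mul_add_form !mul_scale_form y0 eqxx andbT.
have := congr1 (mul_form x) y0.
rewrite mul_formD !mul_formZ mul_formC yx scaler0 addr0 mul_form0 => /eqP.
by rewrite scaler_eq0 (negbTE c'0).
Qed.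

(** columns with at least sqf_one nonzero entry *)
Lemma vanish_col_neq0 N (g : sqf N) c s t : c != 0 ->
  @vanish_col N (g, 0) (s ++ c :: t) <= vanish_prob g (size s + size t).
Proof.
move=> c0; rewrite -cat1s catA vanish_col_cat catA.
by rewrite (le_trans (vanish_col_prefix0 _ _ _)) // vanish_col_single
  // size_cat addnC.
Qed.

(** The coefficients of the product of the rows are the k x k permanental minors
    of the matrix. *)
Definition minors_prob N k := vanish_prob (sqf_one F N) k.

Lemma avg_vec_eq0 k :
  avg (fun c : vec k => (all (pred1 0) (vseq c))%:R) = q^-1 ^+ k.
Proof.
elim: k => [|k IH]; first by rewrite expr0 avg_const ?card_unit.
rewrite avg_cons exprS -IH -(avg_eq1 R (0 : F)).
under eq_avg => c do under eq_avg => x do rewrite /= -mulnb natrM.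
under eq_avg => c do rewrite avgZ mulrC.
by rewrite avgZ mulrC.
Qed.

Lemma minors_prob_col_neq0 N k (c : vec k.+1) :
  ~~ all (pred1 0) (vseq c) ->
  @vanish_col N (sqf_one F N, 0) (vseq c) <= minors_prob N k.
Proof.
case/allPn => a /path.splitPr; move: (size_vseq c).
set l := vseq c => + ll; case: ll => s t.
rewrite size_cat /= addnS => -[<-] a0.
exact: vanish_col_neq0.
Qed.

Lemma minors_prob_col_0 N k (c : vec k) : all (pred1 0) (vseq c) ->
  @vanish_col N (sqf_one F N, 0) (vseq c) = minors_prob N k.
Proof. by move=> /all_pred1P->; rewrite size_vseq vanish_col_nseq0. Qed.

Lemma minors_prob_rec N k :
  minors_prob N.+1 k.+1 <=
  q^-1 ^+ k.+1 * minors_prob N k.+1 + (1 - q^-1 ^+ k.+1) * minors_prob N k.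
Proof.
rewrite {1}/minors_prob vanish_prob_avg_col -(avg_vec_eq0 k.+1).
pose A (c : vec k.+1) : R := (all (pred1 0) (vseq c))%:R; rewrite -/A.
rewrite [X in _ <= X](_ : _ = avg (fun c =>
  minors_prob N k + (minors_prob N k.+1 - minors_prob N k) * A c)); last first.
  by rewrite avgD avgZ (avg_const (minors_prob N k)) ?vecF_gt0 //; ring.
apply: le_avg => c; rewrite /A; case: (boolP (all _ _)) => [c0|c0].
  by rewrite minors_prob_col_0 // mulr1 addrC subrK.
by rewrite mulr0 addr0 minors_prob_col_neq0.
Qed.

Lemma minors_prob_col_pair N k (c c' : F) (s : vec k) : c != 0 -> c' != 0 ->
  (k.+2 <= N)%N ->
  @vanish_col N (sqf_one F N, 0) (c :: c' :: vseq s) <=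
  alpha * minors_prob N k.+1 + (1 - alpha) * minors_prob N k.
Proof.
move=> c0 c'0 kN; rewrite -[_ :: _]/([:: c; c'] ++ vseq s) vanish_col_cat.
rewrite (le_trans (vanish_col_prefix0 _ _ _)) // size_vseq.
by apply: vanish_col_pair (homog_one F N) _.
Qed.

Lemma avg_neq0 : avg (fun c : F => (c != 0)%:R) = 1 - q^-1.
Proof.
rewrite -(avg_eq1 R (0 : F)) -[X in X - _](avg_const _ F_gt0) -[- _]mulN1r.
by rewrite -avgZ -avgD; apply: eq_avg => c; case: eqP => _ /=; ring.
Qed.

(** Three kinds of columns: zero; with first two entries nonzero, of
    probability [beta], which are compared with columns having no other nonzero
    entry; and the others, compared with columns having a single nonzero
    entry. *)
Lemma minors_prob_rec2 N k : (k.+2 <= N)%N ->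
  minors_prob N.+1 k.+2 <=
  q^-1 ^+ k.+2 * minors_prob N k.+2 +
  (1 - q^-1 ^+ k.+2 - beta) * minors_prob N k.+1 +
  beta * (alpha * minors_prob N k.+1 + (1 - alpha) * minors_prob N k).
Proof.
move=> kN; rewrite {1}/minors_prob vanish_prob_avg_col -(avg_vec_eq0 k.+2).
pose A (c : vec k.+2) : R := (all (pred1 0) (vseq c))%:R; rewrite -/A.
pose B (c : vec k.+2) : R := (c.1 != 0)%:R * (c.2.1 != 0)%:R.
have bE : avg B = beta.
  rewrite /B !avg_cons /= expr2 -avg_neq0 mulrC -avgZ.
  apply: eq_avg => a; rewrite [LHS]avg_cons /= mulrC -avgZ.
  by apply: eq_avg => a' /=; rewrite avg_const ?vecF_gt0.
set p2 := minors_prob N k.+2; set p1 := minors_prob N k.+1.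
set p0 := minors_prob N k.
rewrite [X in _ <= X](_ : _ = avg (fun c => p1 +
  ((p2 - p1) * A c + (alpha * p1 + (1 - alpha) * p0 - p1) * B c))); last first.
  by rewrite avgD (avg_const p1) ?vecF_gt0 // avgD !avgZ bE; ring.
apply: le_avg => -[a [a' s]]; rewrite /A /B /=.
have [->|a0] := eqVneq a 0; last have [->|a'0] := eqVneq a' 0.
- rewrite /= mul0r mulr0 addr0; case: (boolP (_ && _)) => [c0|c0].
    rewrite mulr1 addrC subrK /p2.
    by rewrite -(@minors_prob_col_0 N k.+2 (0, (a', s))) //= eqxx.
  by rewrite mulr0 addr0 (@minors_prob_col_neq0 N k.+1 (0, (a', s))) //= eqxx.
- rewrite /= !mulr0 !addr0.
  by apply: (@minors_prob_col_neq0 N k.+1 (a, (0, s))); rewrite /= negb_and a0.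
- rewrite /= !mulr1 mulr0 add0r addrC subrK.
  exact: minors_prob_col_pair.
Qed.

Lemma q_gt0 : 0 < q. Proof. by rewrite ltr0n F_gt0. Qed.

(** The right-hand side is the union bound, over the lines of F^k, for the
    probability that a random k x N matrix has rank less than k; it satisfies
    with equality the recursion of [minors_prob_rec]. *)
Lemma minors_prob_le_proj N k :
  minors_prob N k <= (q ^+ k - 1) / ((q - 1) * q ^+ N).
Proof.
have q3 := q_ge3; have q1 : q - 1 != 0 by rewrite lt0r_neq0 //; lra.
have q0 : q != 0 by rewrite lt0r_neq0 // q_gt0.
have qk j : q ^+ j != 0 by rewrite expf_neq0.
elim: N k => [|N IH] [|k].
- by rewrite /minors_prob vanish_prob0 (negbTE (one_neq0 F 0)) expr0 subrr mul0r.
- apply: (le_trans (vanish_prob_le1 _ _)).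
  rewrite expr0 mulr1 lter_pdivlMr ?mul1r; last lra.
  by rewrite lerD2r exprS ler_peMr ?exprn_ege1 //; lra.
- by rewrite /minors_prob vanish_prob0 (negbTE (one_neq0 F N.+1)) expr0 subrr mul0r.
- apply: (le_trans (minors_prob_rec _ _)).
  have qk1 : 0 <= 1 - q^-1 ^+ k.+1.
    by rewrite subr_ge0 exprn_ile1 // ?invr_ge0 ?invf_le1; lra.
  apply: (@le_trans _ _ (q^-1 ^+ k.+1 * ((q ^+ k.+1 - 1) / ((q - 1) * q ^+ N)) +
    (1 - q^-1 ^+ k.+1) * ((q ^+ k - 1) / ((q - 1) * q ^+ N)))).
    by apply: lerD; rewrite ler_wpM2l // exprn_ge0 // invr_ge0; lra.
  rewrite le_eqVlt; apply/orP; left; apply/eqP.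
  rewrite exprVn !exprS; field.
  by rewrite q0 !qk q1.
Qed.

Lemma minors_prob_le_geo N k :
  minors_prob N k <= (q - 1)^-1 * (q ^+ k / q ^+ N).
Proof.
have q3 := q_ge3; apply: (le_trans (minors_prob_le_proj _ _)).
rewrite invfM mulrCA; apply: ler_wpM2l; first by rewrite invr_ge0; lra.
by rewrite ler_wpM2r ?invr_ge0 ?exprn_ge0 // ?gerBl // ler01.
Qed.

(** The zero column contributes at most 3^(-k) (3/2) q^(k-N), which has to be
    absorbed by the gain in the recursion; with k = j + 2, it is for k >= 7. *)
Lemma expr_decay j : (5 <= j)%N ->
  (1 / 3) ^+ j.+2 <= (1 / 75) * (9 / 10) ^+ j :> R.
Proof.
move=> j5; rewrite (_ : 1 / 3 = 10 / 27 * (9 / 10)); last by field.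
rewrite exprMn [X in _ <= X](_ : _ =
  4 / 243 * ((9 / 10) ^+ j * (9 / 10) ^+ 2)); last by field.
rewrite -exprD addn2; apply: ler_wpM2r; first by rewrite exprn_ge0 //; lra.
apply: (@le_trans _ _ ((10 / 27) ^+ 7)); last by lra.
by rewrite ler_wiXn2l //; try lia; lra.
Qed.

(** For k <= 6 the bound of [minors_prob_le_geo] is already smaller, as
    1/2 <= (9/10)^6.  For k >= 7 the recursion applies, with coefficients in
    which beta >= 4/9 and 1/q <= 1/3. *)
Lemma minors_prob_exp_decay N k : (k < N)%N ->
  minors_prob N k <= (9 / 10) ^+ k * (q ^+ k / q ^+ N).
Proof.
have q3 := q_ge3; have q0 := q_gt0; have qn0 : q != 0 by rewrite lt0r_neq0.
have qk j : q ^+ j != 0 by rewrite expf_neq0.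
have Q0 m n : 0 <= q ^+ m / q ^+ n by rewrite divr_ge0 // exprn_ge0 // ltW.
elim/ltn_ind: k N => k IH N kN.
have [k6|k6] := leqP k 6.
  apply: (le_trans (minors_prob_le_geo _ _)); apply: ler_wpM2r => //.
  apply: (@le_trans _ _ ((9 / 10) ^+ 6)); last first.
    by rewrite ler_wiXn2l //; lra.
  by rewrite -[X in X <= _]mul1r ler_pdivrMr; lra.
case: k k6 IH kN => [//|[//|j]] k6 IH kN.
case: N kN => [//|M] kM.
have {}kM : (j.+2 <= M)%N by [].
apply: (le_trans (minors_prob_rec2 kM)).
set Q := q ^+ j.+2 / q ^+ M.+1.
have Qge0 : 0 <= Q by exact: Q0.
have h2 := minors_prob_le_geo M j.+2.
have h1 := IH j.+1 (ltnSn _) M kM.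
have h0 := IH j (ltnW (ltnSn _)) M (ltnW kM).
have E2 : (q - 1)^-1 * (q ^+ j.+2 / q ^+ M) = q / (q - 1) * Q.
  rewrite /Q [q ^+ M.+1]exprS; field.
  by rewrite qn0 qk lt0r_neq0 //; lra.
have E1 : q ^+ j.+1 / q ^+ M = Q.
  by rewrite /Q [q ^+ M.+1]exprS [q ^+ j.+2]exprS; field; rewrite qn0 qk.
have E0 : q ^+ j / q ^+ M = q^-1 * Q.
  by rewrite /Q [q ^+ M.+1]exprS 2!exprS; field; rewrite qn0 qk.
rewrite E2 in h2; rewrite E1 in h1; rewrite E0 in h0.
have hq : q / (q - 1) <= 3 / 2 by rewrite ler_pdivrMr; lra.
have y0 : 0 <= q^-1 by rewrite invr_ge0 ltW.
have y3 : q^-1 <= 1 / 3 by rewrite div1r lef_pV2 // posrE; lra.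
have e0 : 0 <= q^-1 ^+ j.+2 by rewrite exprn_ge0.
have er : q^-1 ^+ j.+2 <= 1 / 75 * (9 / 10) ^+ j.
  have j5 : (5 <= j)%N by [].
  apply: le_trans (expr_decay j5); apply: lerXn2r y3; rewrite nnegrE //.
have r0 : 0 <= (9 / 10 : R) ^+ j by rewrite exprn_ge0 //; lra.
have ey : q^-1 ^+ j.+2 <= q^-1.
  by rewrite exprS ler_piMr // exprn_ile1 //; lra.
move: h2 h1 h0 hq y0 y3 e0 er r0.
rewrite !(exprS (9 / 10)).
move: (minors_prob M j.+2) (minors_prob M j.+1) (minors_prob M j) => p2 p1 p0.
move: (q / (q - 1)) ((9 / 10) ^+ j) Q Qge0 ey {Q0 E2 E1 E0 IH} => w r Q Q0.
move: (q^-1) (q^-1 ^+ j.+2) => y e ey h2 h1 h0 hq y0 y3 e0 er r0.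
pose b := (1 - y) ^+ 2; rewrite -/b.
have yy : 0 <= y * (1 - y) by apply: mulr_ge0; lra.
have bE : b = 1 - y - y * (1 - y) by rewrite /b; ring.
have b49 : 4 / 9 <= b.
  have : 0 <= (1 / 3 - y) * (5 / 3 - y) by apply: mulr_ge0; lra.
  by rewrite /b; nra.
have by1 : e <= 1 - b by lra.
have b1 : b <= 1 by lra.
have b2 : 16 / 81 <= b ^+ 2.
  have : 0 <= (b - 4 / 9) * (b + 4 / 9) by apply: mulr_ge0; lra.
  by nra.
have c1 : 0 <= 1 - e - b ^+ 2.
  have : 0 <= b * (1 - b) by apply: mulr_ge0; lra.
  by nra.
have l2 : e * p2 <= (1 / 50 * r) * Q.
  apply: (@le_trans _ _ (e * (w * Q))); first exact: ler_wpM2l.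
  by rewrite mulrA ler_wpM2r //; nra.
have l1 : (1 - e - b ^+ 2) * p1 <= (1 - b ^+ 2) * (9 / 10 * r * Q).
  apply: (@le_trans _ _ ((1 - e - b ^+ 2) * (9 / 10 * r * Q))).
    exact: ler_wpM2l.
  by apply: ler_wpM2r; [rewrite !mulr_ge0 //; lra|lra].
have l0 : b ^+ 2 * p0 <= b ^+ 2 * (1 / 3 * (r * Q)).
  apply: ler_wpM2l; first exact: sqr_ge0.
  rewrite (le_trans h0) // mulrCA; apply: ler_wpM2r => //.
  by rewrite mulr_ge0.
have rQ : 0 <= r * Q by rewrite mulr_ge0.
have l3 : 16 / 81 * (r * Q) <= b ^+ 2 * (r * Q) by exact: ler_wpM2r.
rewrite [X in X <= _](_ : _ = e * p2 + (1 - e - b ^+ 2) * p1 + b ^+ 2 * p0);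
  last by ring.
apply: (le_trans (lerD (lerD l2 l1) l0)).
by move: (b ^+ 2) l3 => bb l3; lra.
Qed.

End Vanishing.

(** * Permanents as top coefficients *)

Section Permanent.
Variable F : finFieldType.
Local Notation vec := (vec_of F).
Local Notation sqf := (sqf F).

(** Every permutation s of n+1 points is uniquely the lift of a permutation of
    n points by the prescription that s sends i to 0, where i is the row that
    uses the first column. *)
Lemma permanent_expand_col0 n (A : 'M[F]_n.+1) :
  permanent A = \sum_i A i ord0 * permanent (row' i (col' ord0 A)).
Proof.
pose h (u : 'I_n.+1 * 'S_n) := lift_perm u.1 ord0 u.2.
have h_bij : bijective h.
  apply: inj_card_bij; last by rewrite card_prod card_ord !card_Sn factS.
  move=> [i s] [j t] /= e; have ij : i = j.
    apply: (@perm_inj _ (h (i, s))); rewrite [in RHS]e /h /=.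
    by rewrite !lift_perm_id.
  rewrite -{j}ij in e *; congr (_, _); apply/permP => k.
  by apply: (@lift_inj _ ord0); rewrite -!(lift_perm_lift i) -/(h (i, s)) e.
rewrite /permanent (reindex h) /=; last exact: onW_bij.
rewrite -(pair_big predT predT
  (fun i s => \prod_k A k (lift_perm i ord0 s k))) /=.
apply: eq_bigr => i _; rewrite big_distrr /=; apply: eq_bigr => s _.
rewrite (bigD1_ord i) //= lift_perm_id; congr (_ * _).
by apply: eq_bigr => k _; rewrite !mxE lift_perm_lift.
Qed.

Fixpoint vec_fun (T : finType) n : ('I_n -> T) -> vec_of T n :=
  if n is m.+1 then fun f => (f ord0, vec_fun (fun i => f (lift ord0 i)))
  else fun _ => tt.

Lemma eq_vec_fun (T : finType) n (f g : 'I_n -> T) :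
  f =1 g -> vec_fun f = vec_fun g.
Proof.
by elim: n f g => [//|n IH] f g fg /=; rewrite fg (IH _ _ (fun i => fg _)).
Qed.

Lemma vec_fun_inj (T : finType) n (f g : 'I_n -> T) :
  vec_fun f = vec_fun g -> f =1 g.
Proof.
elim: n f g => [|n IH] f g /=; first by move=> _ [].
by case=> fg0 /IH fgS i; case: (unliftP ord0 i) => [j|] ->.
Qed.

Lemma mul_rowsD N k (r : vec_of (vec N) k) a b :
  mul_rows r (a + b) = mul_rows r a + mul_rows r b.
Proof. by elim: k r a b => [//|k IH] r a b /=; rewrite mul_formD IH. Qed.

Lemma mul_rowsZ N k (r : vec_of (vec N) k) c a :
  mul_rows r (c *: a) = c *: mul_rows r a.
Proof. by elim: k r a => [//|k IH] r a /=; rewrite mul_formZ IH. Qed.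

Lemma mul_rows0 N k (r : vec_of (vec N) k) : mul_rows r 0 = 0.
Proof. by have := mul_rowsZ r 0 0; rewrite !scale0r. Qed.

Lemma mul_rows_cons N k (r : vec_of (vec N) k) x a :
  @mul_rows F N k.+1 (x, r) a = mul_form x (mul_rows r a).
Proof.
rewrite /=; elim: k r a => [//|k IH] r a /=; by rewrite mul_formC IH.
Qed.

Lemma homog_mul_rows N k (r : vec_of (vec N) k) d a :
  homog d a -> homog (k + d) (mul_rows r a).
Proof.
elim: k r d a => [//|k IH] r d a ha /=.
by rewrite addSnnS; apply/IH/homog_mul_form.
Qed.

Lemma topD N (a b : sqf N) : top_coef (a + b) = top_coef a + top_coef b.
Proof. by elim: N a b => [//|N IH] a b /=; rewrite IH. Qed.

Lemma topZ N c (a : sqf N) : top_coef (c *: a) = c * top_coef a.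
Proof. by elim: N a => [//|N IH] a /=; rewrite IH. Qed.

Lemma top0 N : top_coef (0 : sqf N) = 0.
Proof. by elim: N => [//|N IH] /=. Qed.

Lemma top_sum N (I : Type) (s : seq I) (f : I -> sqf N) :
  top_coef (\sum_(i <- s) f i) = \sum_(i <- s) top_coef (f i).
Proof. by elim/big_rec2: _ => [|i y x _ <-]; rewrite ?top0 ?topD. Qed.

(** The Leibniz rule: the part of a product of rows that contains x_1 takes x_1
    either from the element multiplied or from exactly one of the rows.  On the
    top coefficient this is the expansion of the permanent along its first
    column. *)
Lemma mul_rows_snd N k (f : 'I_k -> vec N.+1) (a b : sqf N) :
  (mul_rows (vec_fun f) ((a, b) : sqf N.+1)).2 =
  mul_rows (vec_fun (fun i => (f i).2)) b +
  \sum_i (f i).1 *: mul_rows (vec_fun (fun j => (f (lift i j)).2)) a.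
Proof.
elim: k f a b => [|k IH] f a b; first by rewrite big_ord0 addr0.
rewrite /= IH mul_rowsD mul_rowsZ -addrA; congr (_ + _).
rewrite big_ord_recl; congr (_ + _); apply: eq_bigr => i _; congr (_ *: _).
case: k i IH f => [[] //|k] i _ f /=.
have -> : lift (lift ord0 i) ord0 = ord0 by apply: val_inj.
congr (mul_rows _ _); apply: eq_vec_fun => j; congr ((f _).2).
by apply: val_inj => /=; rewrite /bump; lia.
Qed.

Definition rows_vec k N (A : 'M[F]_(k, N)) : vec_of (vec N) k :=
  vec_fun (fun i => vec_fun (fun j => A i j)).

Lemma permanent_top n (A : 'M[F]_n) :
  permanent A = top_coef (mul_rows (rows_vec A) (sqf_one F n)).
Proof.
elim: n A => [|n IH] A.
  rewrite /permanent (eq_bigr (fun=> 1)); last by move=> s _; rewrite big_ord0.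
  by rewrite sumr_const card_Sn.
rewrite permanent_expand_col0 /= -[X in top_coef X.2]/
  (mul_rows (rows_vec A) (sqf_one F n.+1)).
rewrite mul_rows_snd mul_rows0 add0r top_sum; apply: eq_bigr => i _.
rewrite topZ /= IH; congr (_ * top_coef (mul_rows _ _)).
by apply: eq_vec_fun => k; apply: eq_vec_fun => j; rewrite !mxE.
Qed.

Lemma rows_vec_bij k N : bijective (@rows_vec k N).
Proof.
apply: inj_card_bij; last by rewrite !card_vec card_mx -expnM mulnC.
move=> A B /vec_fun_inj AB; apply/matrixP => i j.
by have /vec_fun_inj := AB i; apply.
Qed.

End Permanent.

(** * Distribution of the permanent *)

Section PermanentDistribution.
Variables (R : realFieldType) (F : finFieldType).
Local Notation vec := (vec_of F).
Local Notation sqf := (sqf F).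
Local Notation q := (#|F|%:R : R).

(** The leading part of h is homogeneous of degree N in N variables; if it is
    nonzero, so is its top coefficient, which is the slope of the functional in
    the first coordinate of x. *)
Lemma top_coef_uniform N (h : sqf N.+1) a : h != 0 -> homog N h ->
  avg (fun x => (top_coef (mul_form x h) == a)%:R) = q^-1.
Proof.
have lead M (u v : sqf M) : u != 0 -> homog M u ->
    avg (fun x => avg (fun c => (top_coef (mul_form x v + c *: u) == a)%:R)) =
    q^-1.
  move=> u0 hu; have tu : top_coef u != 0.
    by apply: contra_neq u0; exact: top_inj.
  rewrite (eq_avg (g := fun=> q^-1)) ?avg_const ?vecF_gt0 // => x.
  rewrite -(avg_eq1 R ((a - top_coef (mul_form x v)) / top_coef u)).
  apply: eq_avg => c.
  congr (nat_of_bool _)%:R; rewrite topD topZ.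
  by apply/eqP/eqP => [<-|->]; field.
elim: N h => [|N IH] [u v] h0 [hu hv]; rewrite avg_cons exchange_avg.
  by apply: (lead 0%N u v) => //; apply: contra_neq h0 => ->; rewrite [v]hv.
have [u0|u0] := eqVneq u 0; last exact: (lead N.+1 u v u0 hu).
have v0 : v != 0 by apply: contra_neq h0 => ->; rewrite u0.
rewrite -(IH v v0 hv); apply: eq_avg => x.
rewrite u0 (eq_avg (g := fun=> (top_coef (mul_form x v) == a)%:R)).
  by rewrite avg_const ?F_gt0.
move=> c; have -> : mul_form x v = mul_form x v + c *: 0.
  by rewrite scaler0 addr0.
by [].
Qed.

(** All rows but one have a zero product with probability p, and then the
    permanent is zero; otherwise it is uniform, being a nonzero linear
    functional of the remaining row. *)
Lemma avg_permanent n a :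
  avg (fun A : 'M[F]_n.+1 => (permanent A == a)%:R) =
  minors_prob R F n.+1 n * (a == 0)%:R + (1 - minors_prob R F n.+1 n) * q^-1.
Proof.
under eq_avg do rewrite permanent_top.
rewrite (avg_bij (fun r => (top_coef (mul_rows r (sqf_one F n.+1)) == a)%:R)
  (rows_vec_bij F n.+1 n.+1)) avg_cons exchange_avg.
pose V (r : vec_of (vec n.+1) n) : R := (mul_rows r (sqf_one F n.+1) == 0)%:R.
have -> : minors_prob R F n.+1 n = avg V by [].
rewrite [RHS](_ : _ = avg (fun r => q^-1 + ((a == 0)%:R - q^-1) * V r)).
  apply: eq_avg => r; rewrite /V.
  under eq_avg => x do rewrite mul_rows_cons.
  have [->|h0] := eqVneq (mul_rows r _) 0.
    under eq_avg => x do rewrite mul_form0 top0 eq_sym.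
    by rewrite avg_const ?vecF_gt0 // mulr1 addrC subrK.
  rewrite mulr0 addr0 top_coef_uniform //.
  by have := homog_mul_rows r (homog_one F n.+1); rewrite addn0.
by rewrite avgD avgZ (avg_const q^-1) ?vec_gt0 ?F_gt0 //; ring.
Qed.

End PermanentDistribution.

(** * From random matrices to counting *)

Section RandomMatrix.
Variables (R : realType) (d : measure_display) (T : measurableType d).
Variables (P : probability T R) (F : finFieldType) (n : nat).
Variables (A : T -> 'M[F]_n) (hA : uniform_random_matrix P A).

Lemma matrix_preimage (M : 'M[F]_n) : A @^-1` [set M] =
  \bigcap_(ij in [set` [set: 'I_n * 'I_n]%SET])
    ((fun t => A t ij.1 ij.2) @^-1` [set M ij.1 ij.2]).
Proof.
apply/seteqP; split => [t /= AM ij _ /=|t H]; first by rewrite AM.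
by apply/matrixP => i j; apply: (H (i, j)); rewrite /= inE.
Qed.

Lemma measurable_matrix_preimage (M : 'M[F]_n) : measurable (A @^-1` [set M]).
Proof.
case: hA => mA _ _; rewrite matrix_preimage.
by apply: fin_bigcap_measurable => [|ij _]; [exact: finite_finset|exact: mA].
Qed.

Lemma law_uniform_matrix (M : 'M[F]_n) : law P A M = #|{: 'M[F]_n}|%:R^-1.
Proof.
case: hA => mA lA iA; rewrite /law matrix_preimage.
rewrite (iA _ (fun ij => [set M ij.1 ij.2])).
rewrite (eq_bigr (fun=> #|F|%:R^-1)); last first.
  by move=> ij _; have := congr1 (@^~ (M ij.1 ij.2)) (lA ij).
by rewrite prodr_const cardsT card_prod card_ord card_mx natrX exprVn.
Qed.

Lemma law_comp_uniform_matrix (S : finType) (f : 'M[F]_n -> S) (x : S) :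
  law P (fun t => f (A t)) x = avg (fun M => (f M == x)%:R).
Proof.
pose r := [seq M <- enum {: 'M[F]_n} | f M == x].
have rE M : (M \in r) = (f M == x) by rewrite mem_filter mem_enum andbT.
have -> : law P (fun t => f (A t)) x =
    fine (P (\bigcup_(M in [set` r]) A @^-1` [set M])).
  congr (fine (P _)); apply/seteqP; split => [t /= fx|t [M /=]].
    by exists (A t) => //=; rewrite rE fx.
  by rewrite rE => /eqP fM ->.
rewrite measure_fin_bigcup //; last 2 first.
- by move=> M N _ _ [t [/= <- <-]].
- by move=> M _; exact: measurable_matrix_preimage.
rewrite -fsbig_seq; last by apply: filter_uniq; exact: enum_uniq.
rewrite -sum_fine; last first.
  by move=> M _; apply: fin_num_measure; exact: measurable_matrix_preimage.
rewrite (eq_bigr (fun=> #|{: 'M[F]_n}|%:R^-1)); last first.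
  by move=> M _; exact: law_uniform_matrix.
rewrite big_filter big_enum_cond /= /avg mulr_sumr.
rewrite big_mkcond; apply: eq_bigr => M _.
by case: ifP; rewrite ?mulr1 ?mulr0.
Qed.

End RandomMatrix.

(** * Total variation bounds *)

Section TotalVariation.
Variables (R : realType) (d : measure_display) (T : measurableType d).
Variables (P : probability T R) (F : finFieldType).
Local Notation q := (#|F|%:R : R).

Lemma per_dTV_eq n (A : T -> 'M[F]_n.+1) : uniform_random_matrix P A ->
  per_dTV P A = (1 - q^-1) * minors_prob R F n.+1 n.
Proof.
move=> hA; have q0 : 0 < q by rewrite ltr0n F_gt0.
rewrite /per_dTV /dTV; under eq_bigr => x _.
  rewrite (law_comp_uniform_matrix hA (@permanent F n.+1)) avg_permanent.
  rewrite /uniform_law; over.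
set p := minors_prob R F n.+1 n; have p0 : 0 <= p := vanish_prob_ge0 _ _ _.
have q1 : q^-1 <= 1 by rewrite invf_le1 // ler1n F_gt0.
have qi : 0 <= q^-1 by rewrite invr_ge0 ltW.
rewrite (bigD1 0) //= eqxx (eq_bigr (fun=> p * q^-1)); last first.
  move=> x /negbTE->; rewrite mulr0 add0r mulrBl mul1r addrAC subrr add0r.
  by rewrite normrN ger0_norm // mulr_ge0.
rewrite sumr_const (_ : #|_| = #|F|.-1)%N; last first.
  by rewrite -(cardC1 (0 : F)); apply: eq_card.
rewrite (_ : (p * q^-1) *+ _ = p * q^-1 * (q - 1)); last first.
  by rewrite -mulr_natr -subn1 natrB ?F_gt0.
rewrite (_ : _ - q^-1 = (1 - q^-1) * p); last by rewrite mulr1; ring.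
rewrite ger0_norm; last by rewrite mulr_ge0 // subr_ge0.
by field; rewrite lt0r_neq0.
Qed.

Lemma law_dist_le_dTV (S : finType) (mu nu : S -> R) x :
  `|mu x - nu x| <= 2 * dTV mu nu.
Proof.
rewrite /dTV mulrA divff // mul1r (bigD1 x) //= lerDl.
by apply: sumr_ge0.
Qed.

(** The factor 2/9 is the maximum of (1 - y) y over y = 1/q <= 1/3. *)
Lemma per_dTV_le n (A : T -> 'M[F]_n) : odd #|F| -> (0 < n)%N ->
  uniform_random_matrix P A -> per_dTV P A <= 2 / 9 * (9 / 10) ^+ n.-1.
Proof.
move=> oddF; case: n A => [//|n] A _ hA; rewrite per_dTV_eq //=.
have q3 : 3 <= q := q_ge3 R oddF.
have := minors_prob_exp_decay R oddF (ltnSn n).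
set p := minors_prob _ _ _ _ => hp.
have qn0 : q != 0 by rewrite lt0r_neq0 //; lra.
have qE : q ^+ n / q ^+ n.+1 = q^-1.
  by rewrite exprS invfM mulrCA mulfV ?mulr1 // expf_neq0.
rewrite qE in hp.
have y3 : q^-1 <= 1 / 3 by rewrite div1r lef_pV2 // posrE; lra.
apply: (@le_trans _ _ ((1 - q^-1) * ((9 / 10) ^+ n * q^-1))).
  by apply: ler_wpM2l => //; lra.
rewrite mulrCA mulrC; apply: ler_wpM2r; first by rewrite exprn_ge0 //; lra.
move: y3; move: (q^-1) => y y3.
have : 0 <= (1 / 3 - y) * (2 / 3 - y) by apply: mulr_ge0; lra.
by lra.
Qed.

Lemma per_dTV_le_inv n (A : T -> 'M[F]_n) : odd #|F| -> (0 < n)%N ->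
  uniform_random_matrix P A -> per_dTV P A <= 2 / n%:R.
Proof.
move=> oddF n0 hA; apply: (le_trans (per_dTV_le oddF n0 hA)).
case: n n0 {A hA} => [//|n] _ /=.
rewrite ler_pdivlMr ?ltr0Sn //.
(* Bernoulli's inequality for (10/9)^n, in multiplied form. *)
have key : (9 / 10 : R) ^+ n * (n%:R + 9) <= 9.
  elim: n => [|n IH]; first by rewrite expr0; lra.
  apply: le_trans IH; rewrite exprSr -mulrA -[n.+1%:R]natr1.
  have : 0 <= (9 / 10 : R) ^+ n by rewrite exprn_ge0 //; lra.
  by move=> r0; apply: ler_wpM2l => //; have := ler0n R n; lra.
have : 0 <= (9 / 10 : R) ^+ n by rewrite exprn_ge0 //; lra.
by rewrite -[n.+1%:R]natr1; lra.
Qed.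

End TotalVariation.

Unset Implicit Arguments.

Theorem corollary1p3 (R : realType) :
  [/\ (* (i) *)
      forall (F : finFieldType) (hF : odd #|F|) (x : F)
        (d : nat -> measure_display) (T : forall n, measurableType (d n))
        (P : forall n, probability (T n) R) (A : forall n, T n -> 'M[F]_n)
        (hA : forall n, uniform_random_matrix (P n) (A n)),
        law (P n) (fun t => permanent (A n t)) x @[n --> \oo] --> (#|F|%:R^-1 : R),
      (* (ii) *)
      forall (F : finFieldType) (hF : odd #|F|) (n : nat) (hn : (7 <= n)%N)
        (d : measure_display) (T : measurableType d)
        (P : probability T R) (A : T -> 'M[F]_n)
        (hA : uniform_random_matrix P A),
        per_dTV P A <=
        1 / n%:R * (10 / 27 * (ln n%:R / ln (27 / 19) + 1) + 1 / 9),
      (* (iii), uniform bound *)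
      exists C : R, 0 < C /\
        forall (F : finFieldType) (hF : odd #|F|) (n : nat) (hn : (7 <= n)%N)
          (d : measure_display) (T : measurableType d)
          (P : probability T R) (A : T -> 'M[F]_n)
          (hA : uniform_random_matrix P A),
          per_dTV P A <= C * (ln n%:R / n%:R)
    & (* (iii), varying field *)
      forall (F : nat -> finFieldType) (hF : forall n, odd #|F n|)
        (d : nat -> measure_display) (T : forall n, measurableType (d n))
        (P : forall n, probability (T n) R)
        (A : forall n, T n -> 'M[F n]_n)
        (hA : forall n, uniform_random_matrix (P n) (A n)),
        (fun n => per_dTV (P n) (A n)) =O_\oo (fun n => ln n%:R / n%:R : R)].

Proof.
have ln7 : 0 < ln (7 : R) by rewrite ln_gt0 //; lra.
have ln_ge7 n : (7 <= n)%N -> ln (7 : R) <= ln n%:R.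
  by move=> n7; rewrite ler_ln ?posrE ?ltr0n ?ler_nat //; lia.
have bound7 (F : finFieldType) (hF : odd #|F|) n (hn : (7 <= n)%N)
    d (T : measurableType d) (P : probability T R) (A : T -> 'M[F]_n)
    (hA : uniform_random_matrix P A) :
    per_dTV P A <= 2 / ln 7 * (ln n%:R / n%:R).
  apply: (le_trans (per_dTV_le_inv hF _ hA)); first by lia.
  rewrite mulrA; apply: ler_wpM2r; first by rewrite invr_ge0.
  by rewrite -mulrA ler_peMr // mulrC ler_pdivlMr // mul1r ln_ge7.
have C0 : 0 < 2 / ln (7 : R) by rewrite divr_gt0.
split.
- move=> F hF x d T P A hA; apply/cvgrPdist_le => e e0; near=> n.
  have n0 : (0 < n)%N by near: n; exact: nbhs_infty_gt.
  rewrite distrC; apply: (le_trans (law_dist_le_dTV _ (uniform_law R F) x)).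
  apply: (@le_trans _ _ (2 * (2 / n%:R))).
    by rewrite ler_wpM2l //; exact: per_dTV_le_inv (hA n).
  rewrite mulrA ler_pdivrMr ?ltr0n // -ler_pdivrMl //; apply/ltW.
  by near: n; exact: nbhs_infty_gtr.
- move=> F hF n hn d T P A hA.
  apply: (le_trans (per_dTV_le_inv hF _ hA)); first by lia.
  rewrite mul1r mulrC; apply: ler_wpM2l; first by rewrite invr_ge0.
  have l0 : 0 < ln (27 / 19 : R) by rewrite ln_gt0 //; lra.
  have : 5 <= ln n%:R / ln (27 / 19 : R).
    rewrite ler_pdivlMr // mulrC mulr_natr -lnXn; last lra.
    apply: le_trans (ln_ge7 _ hn); rewrite ler_ln ?posrE //; lra.
  by lra.
- by exists (2 / ln 7); split.
- move=> F hF d T P A hA; apply/eqOP; near=> k; near=> n.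
  have n7 : (7 <= n)%N by near: n; exact: nbhs_infty_ge.
  rewrite ger0_norm; last first.
    by rewrite mulr_ge0 ?invr_ge0 // sumr_ge0.
  apply: (le_trans (bound7 _ (hF n) _ n7 _ _ _ _ (hA n))).
  apply: ler_pM => //.
  + by rewrite ltW.
  + by rewrite divr_ge0 // (le_trans (ltW ln7)) // ln_ge7.
  + by rewrite ler_norm.
Unshelve. all: by end_near.
Qed.
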